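(* Let $\mathcal{P}$ be a finite 2-dimensional poset and let $L,\overline{L}$ be a diametral pair of linear extensions of the downset lattice $\mathcal{D}_\mathcal{P}$. Let $\sigma$ be the linear extension of $\mathcal{P}$ given by the order in which the principal downsets $x^{\downarrow}$, $x\in\mathcal{P}$, appear in $L$. Then $\sigma$ belongs to a diametral pair $\sigma,\overline{\sigma}$ of linear extensions of $\mathcal{P}$, and $L=L_\sigma$ and $\overline{L}=L_{\overline{\sigma}}$.
   Context: $\mathcal{P}$ is 2-dimensional if it has a realizer $\{L_1,L_2\}$: two linear extensions whose common comparabilities are exactly those of $\mathcal{P}$. $\mathcal{D}_\mathcal{P}$ is the poset of downsets of $\mathcal{P}$ ordered by inclusion. For a linear extension $\sigma$ of $\mathcal{P}$, $L_\sigma$ is the linear order on downsets with $A^{\downarrow}<B^{\downarrow}$ iff $\max_\sigma(A\triangle B)\in B$, where $A,B$ are the antichains of maximal elements and $\max_\sigma S$ is the $\sigma$-largest element of $S$. The distance between two linear extensions is the number of unordered pairs appearing in different orders in them; a diametral pair is a pair of linear extensions of maximum distance. *)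

(* Defs.v *)
From HB Require Import structures.
From mathcomp Require Import all_boot all_order.

Set Implicit Arguments.
Unset Strict Implicit.
Unset Printing Implicit Defensive.

Import Order.TTheory.
Local Open Scope order_scope.

(* Linear orders on a finite type are represented by their reflexive relation,
   so two of them are the same when they are equal pointwise (=2). *)
Definition linear_order (T : finType) (L : rel T) : Prop :=
  [/\ reflexive L, antisymmetric L, transitive L & total L].

Definition linear_extension (d : Order.disp_t) (P : finPOrderType d)
    (L : rel P) : Prop :=
  linear_order L /\ (forall x y : P, x <= y -> L x y).

(* L1 and L2 may coincide, so this reads "dimension at most 2"; the only posets
   it adds to those of dimension exactly 2 are the chains. *)
Definition two_dimensional (d : Order.disp_t) (P : finPOrderType d) : Prop :=
  exists L1 L2 : rel P,
    [/\ linear_extension L1, linear_extension L2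
      & forall x y : P, x <= y <-> L1 x y /\ L2 x y].

Definition distance (T : finType) (L1 L2 : rel T) : nat :=
  #|[set e : {set T} | [exists x, exists y,
       [&& e == [set x; y], x != y, L1 x y & L2 y x]]]|.

Definition diametral_pair (d : Order.disp_t) (P : finPOrderType d)
    (L1 L2 : rel P) : Prop :=
  [/\ linear_extension L1, linear_extension L2
    & forall M1 M2 : rel P, linear_extension M1 -> linear_extension M2 ->
        (distance M1 M2 <= distance L1 L2)%N].

Definition is_downset (d : Order.disp_t) (P : finPOrderType d)
    (A : {set P}) : bool :=
  [forall x in A, forall y, (y <= x) ==> (y \in A)].

Record downset (d : Order.disp_t) (P : finPOrderType d) := Downset {
  downset_set :> {set P};
  downsetP : is_downset downset_set
}.

HB.instance Definition _ (d : Order.disp_t) (P : finPOrderType d) :=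
  [isSub for @downset_set d P].
HB.instance Definition _ (d : Order.disp_t) (P : finPOrderType d) :=
  [Finite of downset P by <:].

Definition downset_le (d : Order.disp_t) (P : finPOrderType d) :
  rel (downset P) := fun A B => (A : {set P}) \subset B.

Lemma downset_le_refl (d : Order.disp_t) (P : finPOrderType d) :
  reflexive (@downset_le d P).
Proof. by move=> A; apply: subxx. Qed.

Lemma downset_le_anti (d : Order.disp_t) (P : finPOrderType d) :
  antisymmetric (@downset_le d P).
Proof. by move=> A B sAB; apply: val_inj; apply/eqP; rewrite eqEsubset. Qed.

Lemma downset_le_trans (d : Order.disp_t) (P : finPOrderType d) :
  transitive (@downset_le d P).
Proof. by move=> B A C; apply: subset_trans. Qed.

HB.instance Definition _ (d : Order.disp_t) (P : finPOrderType d) :=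
  Order.Le_isPOrder.Build Order.SetSubsetOrder.subset_display (downset P)
    (@downset_le_refl d P) (@downset_le_anti d P) (@downset_le_trans d P).

Lemma principal_subproof (d : Order.disp_t) (P : finPOrderType d) (x : P) :
  is_downset [set y | y <= x].
Proof.
apply/forall_inP => y; rewrite inE => le_yx.
by apply/forallP => z; apply/implyP => le_zy; rewrite inE (le_trans le_zy).
Qed.

Definition principal (d : Order.disp_t) (P : finPOrderType d) (x : P) :
  downset P := Downset (principal_subproof x).

Definition maximal_elements (d : Order.disp_t) (P : finPOrderType d)
    (D : {set P}) : {set P} :=
  [set x in D | [forall y in D, (x <= y) ==> (y == x)]].

Definition symdiff (T : finType) (A B : {set T}) : {set T} :=
  (A :\: B) :|: (B :\: A).

Definition max_elt (T : finType) (s : rel T) (S : {set T}) : option T :=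
  [pick m in S | [forall z in S, s z m]].

Definition L_of (d : Order.disp_t) (P : finPOrderType d) (s : rel P) :
  rel (downset P) := fun D E =>
  let A := maximal_elements D in
  let B := maximal_elements E in
  (D == E) || (if max_elt s (symdiff A B) is Some m then m \in B else false).

Definition principal_order (d : Order.disp_t) (P : finPOrderType d)
    (L : rel (downset P)) : rel P :=
  fun x y => L (principal x) (principal y).

(* Main.v *)
Require Import Defs.
From mathcomp Require Import all_boot all_order.
From mathcomp Require Import zify.

(** Two downsets with intersection I and union U split the subposet U \ I into two
    unions of connected components, so the pairs (D, E) with given (I, U) form a
    Boolean algebra. In it the pairs whose first entry is the larger one in a linear
    extension form an up-set containing half of the algebra, and Harris's
    inequality shows that two linear extensions reverse at most a quarter of the
    pairs. For a realizer of P the two orders L_s attain this bound whenever U \ I is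
    disconnected, because the two maxima of U \ I lie in different components; hence
    a diametral pair L, Lbar attains it in every such block. The pairs (X, Y) of a block
    on which L and Lbar agree that X is larger then make up exactly a quarter of it, so
    if they include all X containing two given elements r, r' of different
    components, there are no others. This yields that L and Lbar reverse incomparable
    principal downsets, and, by induction on the size of the union of D and E, that the
    larger of D and E is the one containing the sigma-maximum of their symmetric
    difference. *)

Set Implicit Arguments.
Unset Strict Implicit.
Unset Printing Implicit Defensive.

Import Order.TTheory.
Local Open Scope order_scope.

(** * Linear orders as relations, and counting by bijections *)

Section LinearOrder.
Variables (T : finType) (s : rel T).
Hypothesis lin_s : linear_order s.

Lemma lin_refl x : s x x. Proof. by case: lin_s. Qed.

Lemma lin_trans y x z : s x y -> s y z -> s x z.
Proof. by case: lin_s => _ _ tr _; apply: tr. Qed.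

Lemma lin_anti x y : s x y -> s y x -> x = y.
Proof. by case: lin_s => _ an _ _ xy yx; apply: an; rewrite xy. Qed.

Lemma lin_total x y : s x y || s y x.
Proof. by case: lin_s. Qed.

Lemma lin_notW x y : ~~ s x y -> s y x.
Proof. by move=> /negPf nxy; have := lin_total x y; rewrite nxy. Qed.

Lemma lin_max (A : {set T}) x0 :
  x0 \in A -> exists2 m, m \in A & forall z, z \in A -> s z m.
Proof.
(* The number of elements below a point serves as its rank in [s]; an element of [A] not below [m]
   would have a larger rank. *)
move=> Ax0; case: (arg_maxnP (fun m => #|[set z | s z m]|) Ax0) => m Am max_m.
exists m => // z Az; apply: contraT => nzm; have mz := lin_notW nzm.
have := max_m z Az; rewrite /= leqNgt => /negP[]; apply: proper_card.
apply/properP; split.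
  by apply/subsetP => w; rewrite !inE => /lin_trans; apply.
by exists z; rewrite inE ?lin_refl.
Qed.

End LinearOrder.

(** Each reversed unordered pair has exactly one orientation that is increasing in [s], by
    antisymmetry, so sets of size two can be replaced by ordered pairs. *)
Lemma distance_ordered (T : finType) (s t : rel T) : linear_order s ->
  distance s t = #|[set p : T * T | [&& p.1 != p.2, s p.1 p.2 & t p.2 p.1]]|.
Proof.
move=> lin_s; rewrite /distance -(@card_in_imset _ _ (fun p => [set p.1; p.2])).
  apply: eq_card => e; rewrite inE; apply/existsP/imsetP.
    case=> x /existsP[y /and4P[/eqP-> nxy sxy tyx]].
    by exists (x, y); rewrite ?inE /= ?nxy ?sxy.
  case=> -[x y]; rewrite inE /= => /and3P[nxy sxy tyx] ->.
  by exists x; apply/existsP; exists y; rewrite eqxx nxy sxy.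
move=> [x y] [x' y']; rewrite !inE /= => /and3P[nxy sxy _] /and3P[_ sxy' _] eq_e.
have: x \in [set x'; y'] by rewrite -eq_e set21.
have: y \in [set x'; y'] by rewrite -eq_e set22.
rewrite !inE => /orP[] /eqP ey /orP[] /eqP ex; subst; rewrite ?eqxx // in nxy *.
by rewrite (lin_anti lin_s sxy sxy') eqxx in nxy.
Qed.

Lemma card_cancel_in (T T' : finType) (A : {set T}) (B : {set T'}) f g :
  {in A, forall x, f x \in B /\ g (f x) = x} ->
  {in B, forall y, g y \in A /\ f (g y) = y} -> #|A| = #|B|.
Proof.
move=> fAB gBA; have/card_in_imset <- : {in A &, injective f}.
  by move=> x y /fAB[_ {2}<-] /fAB[_ {2}<-] ->.
apply: eq_card => y; apply/imsetP/idP => [[x Ax ->]|By]; first by case: (fAB x Ax).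
by exists (g y); case: (gBA y By).
Qed.

Lemma card_involutive_in (T : finType) (A : {set T}) (f : T -> T) (Q : pred T) :
  {in A, forall x, f x \in A} -> {in A, forall x, f (f x) = x} ->
  #|[set x in A | Q (f x)]| = #|[set x in A | Q x]|.
Proof.
move=> fA fK; apply: (card_cancel_in (f := f) (g := f)) => x;
  by rewrite !inE => /andP[Ax Qx]; rewrite fA ?fK.
Qed.

(** * Blocks of pairs of downsets *)

Section Downsets.
Variables (d : Order.disp_t) (P : finPOrderType d).
Implicit Types (D E X Y : downset P) (x y z m a : P) (I U : {set P}).
Implicit Types (p : downset P * downset P).

Lemma is_downsetP (A : {set P}) :
  reflect (forall x y, y <= x -> x \in A -> y \in A) (is_downset A).
Proof.
apply: (iffP forall_inP) => [dA x y yx Ax | dA x Ax].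
  by have /forallP/(_ y)/implyP/(_ yx) := dA x Ax.
by apply/forallP => y; apply/implyP => yx; apply: dA Ax.
Qed.

Lemma downset_closed D x y : y <= x -> x \in downset_set D -> y \in downset_set D.
Proof. by move: x y; apply/is_downsetP/downsetP. Qed.

Lemma principal_sub D x : x \in downset_set D -> principal x <= D.
Proof.
by move=> Dx; apply/subsetP => y; rewrite inE => /downset_closed; apply.
Qed.

Lemma downset_eqP D E :
  (forall x, (x \in downset_set D) = (x \in downset_set E)) -> D = E.
Proof. by move=> eqDE; apply/val_inj/setP. Qed.

Lemma meet_subproof D E : is_downset (D :&: E).
Proof.
apply/is_downsetP => x y yx; rewrite !inE => /andP[].
by do 2!move/(downset_closed yx)->.
Qed.
Definition meetd D E := Downset (meet_subproof D E).

Lemma join_subproof D E : is_downset (D :|: E).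
Proof.
apply/is_downsetP => x y yx; rewrite !inE.
by case/orP=> /(downset_closed yx)->; rewrite ?orbT.
Qed.
Definition joind D E := Downset (join_subproof D E).

Lemma in_meetd D E x :
 (x \in (downset_set (meetd D E))) = (x \in downset_set D) && (x \in downset_set E).
Proof. by rewrite inE. Qed.

Lemma in_joind D E x :
  (x \in downset_set (joind D E)) = (x \in downset_set D) || (x \in downset_set E).
Proof. by rewrite inE. Qed.

Lemma exists_downset (A : {set P}) : is_downset A ->
  exists D, forall x, (x \in downset_set D) = (x \in A).
Proof. by move=> dA; exists (Downset dA). Qed.

(** The pairs are ordered, and the second entry is the complement of the first relative to the
    interval from [I] to [U]. The sets [I] and [U] are arbitrary, so a block may be empty. *)
Definition block I U : {set downset P * downset P} :=
  [set p : downset P * downset P | (p.1 :&: p.2 == I) && (p.1 :|: p.2 == U)].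

Lemma blockP I U p :
  reflect (forall x, (x \in downset_set p.1) && (x \in downset_set p.2) = (x \in I)
        /\ (x \in downset_set p.1) || (x \in downset_set p.2) = (x \in U))
    (p \in block I U).
Proof.
rewrite inE; apply: (iffP andP) => [[/eqP<- /eqP<-] x | eqIU].
  by rewrite !inE.
by split; apply/eqP/setP => x; rewrite !inE; case: (eqIU x).
Qed.

Lemma block_self D E : (D, E) \in block (D :&: E) (D :|: E).
Proof. by rewrite inE !eqxx. Qed.

Definition swap p : downset P * downset P := (p.2, p.1).

Lemma swap_block I U p : p \in block I U -> swap p \in block I U.
Proof. by rewrite !inE /= setIC setUC. Qed.

Lemma card_block_swap I U (Q : pred (downset P * downset P)) :
  #|[set p in block I U | Q (swap p)]| = #|[set p in block I U | Q p]|.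
Proof.
by apply: (@card_involutive_in _ _ swap) => [p /swap_block | [? ?]].
Qed.

(** Swapping the entries exchanges the pairs counted here with the others. A pair fixed by this
    exchange would have equal entries, which forces [I = U]. *)
Lemma block_half (L : rel (downset P)) I U : linear_order L -> I != U ->
  (#|[set p in block I U | L p.2 p.1]|).*2 = #|block I U|.
Proof.
move=> linL neIU.
rewrite -(cardsID [set p | L p.2 p.1] (block I U)) -addnn.
congr (_ + _); first by apply: eq_card => p; rewrite !inE.
rewrite -(card_block_swap I U (fun p => L p.2 p.1)).
apply: eq_card => p; rewrite [LHS]inE [RHS]inE inE andbC.
case bp: (p \in block I U); rewrite ?andbF //= !andbT.
apply/idP/idP => [Lp | /(lin_notW linL)//].
apply/negP => Lp'; case/negP: neIU.
have e12 := lin_anti linL Lp Lp'; move: bp; rewrite inE e12 setIid setUid.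
by case/andP=> /eqP<-.
Qed.

(** For [(X, Y)] and [p] in the same block, this exchanges the two entries of [p] on [Y :\: X] and
    leaves them alone on [X :\: Y]: it is addition of [Y] in the Boolean algebra of the block. *)
Definition block_toggle X Y p :=
  (joind (meetd p.1 X) (meetd p.2 Y), joind (meetd p.2 X) (meetd p.1 Y)).

Lemma toggle_block I U X Y p :
  (X, Y) \in block I U -> p \in block I U -> block_toggle X Y p \in block I U.
Proof.
move=> /blockP bXY /blockP bp; apply/blockP => x; rewrite !in_joind !in_meetd.
by case: (bXY x) (bp x) => [<- <-] [] /=; do 4?case: (x \in _).
Qed.

Lemma toggleK I U X Y p :
  (X, Y) \in block I U -> p \in block I U ->
  block_toggle X Y (block_toggle X Y p) = p.
Proof.
move=> /blockP bXY /blockP bp; rewrite [RHS]surjective_pairing; congr pair;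
  apply: downset_eqP => x; rewrite !in_joind !in_meetd !in_joind !in_meetd;
  by case: (bXY x) (bp x) => [<- <-] [] /=; do 4?case: (x \in _).
Qed.

Section Quarter.
Variables (X Y : downset P) (r r' : P).
Hypotheses (rX : r \in X :\: Y) (rY : r' \in Y :\: X).
Let B := block (X :&: Y) (X :|: Y).

Lemma block_split p x : p \in B -> x \in X :\: Y \/ x \in Y :\: X ->
  (x \in downset_set p.2) = (x \notin downset_set p.1).
Proof.
move/blockP/(_ x); rewrite !inE => -[].
by case: (x \in downset_set X); case: (x \in downset_set Y);
   case: (x \in _) => //=; case: (x \in _) => //= _ _ [].
Qed.

(** The four classes given by membership of [r] and [r'] in the first entry have equal size: [swap]
    changes both memberships, and [block_toggle X Y] changes only that of [r']. *)
Lemma block_quarters :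
    #|[set p in B | (r \in downset_set p.1) && (r' \in downset_set p.1)]| * 4 = #|B|
 /\ #|[set p in B | (r \in downset_set p.1) && (r' \in downset_set p.2)]| * 4 = #|B|.
Proof.
pose Q (b b' : bool) p :=
  ((r \in downset_set p.1) == b) && ((r' \in downset_set p.1) == b').
pose c b b' := #|[set p in B | Q b b' p]|.
have inr2 p : p \in B -> (r \in downset_set p.2) = (r \notin downset_set p.1).
  by move=> bp; apply: block_split => //; left.
have inr2' p : p \in B -> (r' \in downset_set p.2) = (r' \notin downset_set p.1).
  by move=> bp; apply: block_split => //; right.
have flip b b' : c (~~ b) (~~ b') = c b b'.
  rewrite {2}/c -(card_block_swap _ _ (Q b b')).
  apply: eq_card => p; rewrite [LHS]inE [RHS]inE.
  case bp: (p \in B) => //=; rewrite /Q inr2 // inr2' //.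
  by case: (r \in _); case: (r' \in _); case: b; case: b'.
have togg b b' : c b (~~ b') = c b b'.
  have bXY := block_self X Y.
  rewrite {2}/c -(@card_involutive_in _ _ (block_toggle X Y) (Q b b')).
  - apply: eq_card => p; rewrite [LHS]inE [RHS]inE.
    case bp: (p \in B) => //=; rewrite /Q !in_joind !in_meetd inr2 // inr2' //.
    move: rX rY; rewrite !inE => /andP[/negPf-> ->] /andP[/negPf-> ->].
    rewrite !(andbT, andbF, orbF) /=.
    by case: (r' \in _); case: b'; rewrite ?andbF ?andbT.
  - by move=> p; apply: toggle_block.
  - by move=> p; apply: toggleK.
have -> : [set p in B | (r \in downset_set p.1) && (r' \in downset_set p.2)] =
    [set p in B | Q true false p].
  apply/setP => p; rewrite [LHS]inE [RHS]inE; case bp: (p \in B) => //=.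
  by rewrite /Q inr2' // eqb_id eqbF_neg.
have -> : [set p in B | (r \in downset_set p.1) && (r' \in downset_set p.1)] =
    [set p in B | Q true true p].
  by apply/setP => p; rewrite [LHS]inE [RHS]inE /Q !eqb_id.
rewrite -!/(c _ _).
have tot : #|B| = c true true + c true false + (c false true + c false false).
  rewrite -(cardsID [set p | r \in downset_set p.1] B).
  rewrite -(cardsID [set p | r' \in downset_set p.1] (B :&: _)).
  rewrite -(cardsID [set p | r' \in downset_set p.1] (B :\: _)).
  congr (_ + _ + (_ + _)); apply: eq_card => p;
    rewrite [LHS]inE [RHS]inE /Q !inE ?eqb_id ?eqbF_neg;
    by do 4?case: (_ \in _) => //=; rewrite ?andbF ?andbT.
rewrite tot; have := togg true true; have := togg false true.
have := flip true true; rewrite /= => -> -> ->; lia.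
Qed.

End Quarter.
End Downsets.

(** * Harris's inequality on a block *)

(** Chebyshev's sum inequality for two terms, from $(f_1-f_0)(g_1-g_0)\ge 0$. It is the arithmetic
    of the induction step of [harris_block], with [b] the size of half a block. *)
Lemma chebyshev_two (f0 f1 g0 g1 b h0 h1 : nat) :
  (f0 <= f1 -> g0 <= g1 -> f0 * g0 <= b * h0 -> f1 * g1 <= b * h1 ->
  (f0 + f1) * (g0 + g1) <= (b + b) * (h0 + h1))%N.
Proof. by move=> /subnKC <- /subnKC <-; move: (f1 - f0) (g1 - g0) => f g; nia. Qed.

Section Harris.
Variables (d : Order.disp_t) (P : finPOrderType d).
Implicit Types (D E X Y : downset P) (x y z m a : P) (I U : {set P}).
Implicit Types (p q : downset P * downset P).
Implicit Types (F G : pred (downset P * downset P)).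

(** Inside a block the two conditions on the entries are equivalent, and this says that [F] is an
    up-set. It is required of all pairs so that it survives joining an entry with a fixed downset,
    which leads from one block to another. *)
Definition block_monotone F :=
  forall X Y X' Y', X <= X' -> Y' <= Y -> F (X, Y) -> F (X', Y').

Lemma meetd_sub D E : meetd D E <= D. Proof. exact: subsetIl. Qed.
Lemma sub_joind D E : D <= joind D E. Proof. exact: subsetUl. Qed.

Section AtomSplit.
Variables (I U : {set P}) (X Y : downset P) (w : P).
Hypothesis blockXY : (X, Y) \in block I U.
Hypotheses (Xw : w \in downset_set X) (Yw : w \notin downset_set Y).
Hypothesis atomX : forall p x, p \in block I U ->
  x \in X :\: Y -> (x \in downset_set p.1) = (w \in downset_set p.1).

Let below q := (q.1, joind q.2 X).
Let above q := (joind q.1 X, q.2).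

(** No pair of the block splits [X :\: Y], so the block consists of two copies of [block I Y]: one
    with [X :\: Y] added to the second entry ([below]), one with it added to the first ([above]).
    Intersecting that entry with [Y] is the inverse map. *)
Lemma card_block_atom F :
  #|[set p in block I U | F p]| =
  (#|[set q in block I Y | F (below q)]| + #|[set q in block I Y | F (above q)]|)%N.
Proof.
have bXY x : (x \in I) = (x \in downset_set X) && (x \in downset_set Y)
          /\ (x \in U) = (x \in downset_set X) || (x \in downset_set Y).
  by move/blockP: blockXY => /(_ x)[<- <-].
have bq q x : q \in block I Y ->
    [/\ (x \in downset_set q.1) && (x \in downset_set q.2)
         = (x \in downset_set X) && (x \in downset_set Y)
      & (x \in downset_set q.1) || (x \in downset_set q.2) = (x \in downset_set Y)].
  by case/blockP/(_ x) => -> ->; case: (bXY x).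
have bp p x : p \in block I U ->
    [/\ (x \in downset_set p.1) && (x \in downset_set p.2)
         = (x \in downset_set X) && (x \in downset_set Y),
        (x \in downset_set p.1) || (x \in downset_set p.2)
         = (x \in downset_set X) || (x \in downset_set Y)
      & (x \in downset_set X) && (x \notin downset_set Y) ==>
        ((x \in downset_set p.1) == (w \in downset_set p.1))].
  move=> bp; move/blockP: (bp) => /(_ x)[-> ->]; case: (bXY x) => -> ->; split => //.
  by apply/implyP => /andP[xX xY]; rewrite (atomX bp) // inE xX xY.
rewrite -(cardsID [set p : downset P * downset P | w \notin downset_set p.1]
            [set p in _ | F p]).
have q1w q : q \in block I Y -> w \notin downset_set q.1.
  by move=> b_q; case: (bq q w b_q) => _; rewrite (negPf Yw); case: (w \in _).
congr addn.
  apply: (card_cancel_in (f := fun p => (p.1, meetd p.2 Y)) (g := below)) => p.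
    case/setIP; rewrite inE => /andP[b_p Fp]; rewrite inE => np.
    have eq_p : below (p.1, meetd p.2 Y) = p.
      rewrite [RHS]surjective_pairing; congr pair; apply: downset_eqP => x.
      rewrite in_joind in_meetd; case: (bp p x b_p); rewrite (negPf np).
      by do 4?case: (x \in _).
    rewrite inE eq_p Fp andbT; split=> //; apply/blockP => x; rewrite in_meetd /=.
    case: (bp p x b_p); rewrite (negPf np); case: (bXY x) => -> _.
    by do 4?case: (x \in _).
  rewrite inE => /andP[b_q Fq]; split.
    apply/setIP; split; last by rewrite inE (q1w _ b_q).
    rewrite inE Fq andbT; apply/blockP => x.
    rewrite in_joind /=; case: (bq p x b_q); case: (bXY x) => -> ->.
    by do 4?case: (x \in _).
  rewrite [RHS]surjective_pairing; congr pair; apply: downset_eqP => x.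
  rewrite in_meetd in_joind; case: (bq p x b_q).
  by do 4?case: (x \in _).
apply: (card_cancel_in (f := fun p => (meetd p.1 Y, p.2)) (g := above)) => p.
  case/setDP; rewrite inE => /andP[b_p Fp]; rewrite inE negbK => np.
  have eq_p : above (meetd p.1 Y, p.2) = p.
    rewrite [RHS]surjective_pairing; congr pair; apply: downset_eqP => x.
    rewrite in_joind in_meetd; case: (bp p x b_p); rewrite np.
    by do 4?case: (x \in _).
  rewrite inE eq_p Fp andbT; split=> //; apply/blockP => x; rewrite in_meetd /=.
  case: (bp p x b_p); rewrite np; case: (bXY x) => -> _.
  by do 4?case: (x \in _).
rewrite inE => /andP[b_q Fq]; split.
  apply/setDP; split; last by rewrite inE in_joind Xw orbT.
  rewrite inE Fq andbT; apply/blockP => x.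
  rewrite in_joind /=; case: (bq p x b_q); case: (bXY x) => -> ->.
  by do 4?case: (x \in _).
rewrite [RHS]surjective_pairing; congr pair; apply: downset_eqP => x.
rewrite in_meetd in_joind; case: (bq p x b_q).
by do 4?case: (x \in _).
Qed.

End AtomSplit.

(** A pair whose first entry is smallest, among those whose first entry is not contained in the
    second, is an atom: if [q] separated two points of [X :\: Y], then [(meetd q.1 X, joind q.2 Y)]
    would be smaller. *)
Lemma exists_atom I U p0 x0 : p0 \in block I U -> x0 \in U :\: I ->
  exists X Y w, [/\ (X, Y) \in block I U, w \in downset_set X, w \notin downset_set Y
   & forall p x, p \in block I U -> x \in X :\: Y ->
       (x \in downset_set p.1) = (w \in downset_set p.1)].
Proof.
move=> /blockP bp0; rewrite inE => /andP[nIx0 Ux0].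
pose Q p := (p \in block I U) &&
  [exists w, (w \in downset_set p.1) && (w \notin downset_set p.2)].
(* This is the pair of [U] and [I] themselves, the top of the algebra. *)
have Q0 : Q (joind p0.1 p0.2, meetd p0.1 p0.2).
  apply/andP; split.
    apply/blockP => x; rewrite in_joind in_meetd; case: (bp0 x) => <- <-.
    by do 2!case: (x \in _).
  apply/existsP; exists x0; rewrite in_joind in_meetd.
  by case: (bp0 x0) => -> ->; rewrite nIx0 Ux0.
case: (arg_minnP (fun p => #|downset_set p.1|) Q0) => -[X Y].
case/andP => bXY /existsP[w /andP[Xw Yw]] min_XY.
exists X, Y, w; split=> // p x bp; rewrite inE => /andP[Yx Xx].
suff H q y z : q \in block I U -> y \in X :\: Y -> z \in X :\: Y ->
    y \in downset_set q.1 -> z \in downset_set q.1.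
  by apply/idP/idP; apply: (H p) => //; rewrite inE ?Xx ?Xw ?Yw ?Yx.
move=> bq /setDP[Xy Yy] /setDP[Xz Yz] qy; apply: contraT => qz.
have /min_XY : Q (meetd q.1 X, joind q.2 Y).
  apply/andP; split.
    apply/blockP => v; rewrite in_joind in_meetd /=.
    move/blockP: bq => /(_ v)[]; move/blockP: bXY => /(_ v)[<- <-] /=.
    by do 4?case: (v \in _).
  apply/existsP; exists y; rewrite in_joind in_meetd /= qy Xy (negPf Yy) orbF /=.
  move/blockP: bq => /(_ y)[]; move/blockP: bXY => /(_ y)[<- <-].
  by rewrite qy Xy (negPf Yy) /= => ->.
rewrite /= leqNgt => /negP[]; apply: proper_card; apply/properP; split.
  exact: subsetIr.
by exists z; rewrite ?inE ?(negPf qz).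
Qed.

(** Induction on [U :\: I]: an atom splits the block into two halves, each a copy of a smaller
    block, and by monotonicity both counts are at least as large in the half with the atom in the
    first entry. *)
Lemma harris_block I U F G : block_monotone F -> block_monotone G ->
  (#|[set p in block I U | F p]| * #|[set p in block I U | G p]|
   <= #|block I U| * #|[set p in block I U | F p && G p]|)%N.
Proof.
have [n leQn] := ubnP #|U :\: I|; elim: n U F G leQn => // n IHn U F G leQn mF mG.
have [-> | [p0 bp0]] := set_0Vmem (block I U).
  rewrite (_ : [set p in set0 | F p] = set0) ?cards0 //.
  by apply/setP => p; rewrite !inE.
have [Q0 | [x0 Qx0]] := set_0Vmem (U :\: I).
  have eq_b : block I U = [set p0].
    apply/setP => p; rewrite in_set1; apply/idP/eqP => [bp | -> //].
    rewrite [LHS]surjective_pairing [RHS]surjective_pairing; congr pair;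
      apply: downset_eqP => x; move/setP/(_ x): Q0; rewrite !inE;
      move/blockP: bp => /(_ x)[]; move/blockP: bp0 => /(_ x)[<- <-];
      by do 4?case: (x \in _).
  have cardQ (Q : pred (downset P * downset P)) : #|[set p in block I U | Q p]| = Q p0.
    rewrite eq_b; case Qp0: (Q p0).
      rewrite -[RHS](cards1 p0); apply: eq_card => p.
      by rewrite !inE; case: eqP => //= ->.
    apply: eq_card0 => p; rewrite !inE; by case: eqP => //= ->.
  by rewrite !cardQ eq_b cards1; case: (F p0); case: (G p0).
have [X [Y [w [bXY Xw Yw atomX]]]] := exists_atom bp0 Qx0.
have cardQ := card_block_atom bXY Xw Yw atomX.
have ltQ : (#|Y :\: I| < n)%N.
  rewrite ltnS in leQn; apply: leq_trans leQn; apply: proper_card.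
  move/blockP: bXY => bXY; apply/properP; split.
    apply/subsetP => x; rewrite !inE => /andP[-> Yx].
    by case: (bXY x) => _ <-; rewrite /= Yx orbT.
  exists w; case: (bXY w) => eI eU; last by rewrite inE (negPf Yw) andbF.
  by rewrite inE -eI -eU /= Xw (negPf Yw).
have card_b : #|block I U| = (#|block I Y| + #|block I Y|)%N.
  have setK (A : {set downset P * downset P}) : [set p in A | predT p] = A.
    by apply/setP => p; rewrite !inE andbT.
  by have := cardQ predT; rewrite !setK.
have monoB H : block_monotone H -> block_monotone (fun q => H (q.1, joind q.2 X)).
  by move=> mH X1 Y1 X2 Y2 leX leY; apply: mH => //; apply: setSU.
have monoA H : block_monotone H -> block_monotone (fun q => H (joind q.1 X, q.2)).
  by move=> mH X1 Y1 X2 Y2 leX leY; apply: mH => //; apply: setSU.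
have leBA H : block_monotone H ->
    (#|[set q in block I Y | H (q.1, joind q.2 X)]|
     <= #|[set q in block I Y | H (joind q.1 X, q.2)]|)%N.
  move=> mH; apply/subset_leq_card/subsetP => q; rewrite inE => /andP[bq Hq].
  by rewrite inE bq /=; apply: mH Hq; apply: sub_joind.
have := IHn _ _ _ ltQ (monoB F mF) (monoB G mG).
have := IHn _ _ _ ltQ (monoA F mF) (monoA G mG).
have := leBA F mF; have := leBA G mG.
rewrite (cardQ F) (cardQ G) (cardQ (fun p => F p && G p)) card_b.
by move=> leG leF FG1 FG0; apply: chebyshev_two.
Qed.

Lemma ext_monotone (L : rel (downset P)) : linear_extension L ->
  block_monotone (fun p => L p.2 p.1).
Proof.
case=> linL extL X Y X' Y' leX leY /= LYX.
by apply: (lin_trans linL (extL _ _ leY)); apply: (lin_trans linL LYX); apply: extL.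
Qed.

Definition reversals (L1 L2 : rel (downset P)) I U :=
  [set p in block I U | [&& p.1 != p.2, L1 p.1 p.2 & L2 p.2 p.1]].

Definition agreements (L1 L2 : rel (downset P)) I U :=
  [set p in block I U | L1 p.2 p.1 && L2 p.2 p.1].

(** Both kinds of pairs have the larger entry of [L2] first, and they are disjoint because [L1]
    orders them oppositely. *)
Lemma reversals_agreements (L1 L2 : rel (downset P)) I U : linear_order L1 ->
  (#|reversals L1 L2 I U| + #|agreements L1 L2 I U|
   <= #|[set p in block I U | L2 p.2 p.1]|)%N.
Proof.
move=> lin1; rewrite -cardsUI [X in (_ + X)%N](_ : _ = 0); last first.
  apply: eq_card0 => p; apply/negP => /setIP[]; rewrite inE.
  case/and4P=> _ /eqP ne12 L12 _; rewrite inE => /and3P[_ L21 _].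
  exact/ne12/(lin_anti lin1).
rewrite addn0; apply/subset_leq_card/subsetP => p.
by case/setUP; rewrite ?/reversals ?/agreements inE;
  [case/and4P=> bp _ _ L2p | case/and3P=> bp _ L2p]; rewrite inE bp.
Qed.

(** Each of [L1], [L2] puts the larger entry first in half of the block, so by Harris's inequality
    at least a quarter are agreements. At most a quarter remains for the reversals. *)
Lemma reversals_bound (L1 L2 : rel (downset P)) I U :
  linear_extension L1 -> linear_extension L2 ->
  (#|reversals L1 L2 I U| * 4 <= #|block I U|)%N.
Proof.
move=> ext1 ext2; have [lin1 _] := ext1; have [lin2 _] := ext2.
have [-> | neIU] := eqVneq I U.
  rewrite [reversals _ _ _ _](_ : _ = set0) ?cards0 //.
  apply/setP => p; rewrite [LHS]inE [RHS]inE.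
  apply/negP => /andP[/blockP bp /andP[/eqP ne12 _]]; apply: ne12.
  by apply: downset_eqP => x; case: (bp x) => <-; do 2!case: (x \in _).
have := harris_block I U (ext_monotone ext1) (ext_monotone ext2).
have := block_half lin1 neIU; have := block_half lin2 neIU.
have := reversals_agreements L2 I U lin1; rewrite -/(agreements L1 L2 I U).
move: #|agreements _ _ _ _| #|reversals _ _ _ _| #|block I U| => a t b.
move: #|_| #|_| => f2 f1; nia.
Qed.

(** Every pair lies in exactly one block, that of its own intersection and union. *)
Lemma distance_reversals (L1 L2 : rel (downset P)) : linear_order L1 ->
  distance L1 L2 = (\sum_(k : {set P} * {set P}) #|reversals L1 L2 k.1 k.2|)%N.
Proof.
move=> lin1; rewrite distance_ordered // -sum1_card.
rewrite (partition_big (fun p => (p.1 :&: p.2, p.1 :|: p.2)) predT) //=.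
apply: eq_bigr => -[I U] _ /=; rewrite -sum1_card; apply: eq_bigl => p.
by rewrite !inE xpair_eqE andbC.
Qed.

End Harris.

(** * The orders L_s *)

Section Revlex.
Variables (d : Order.disp_t) (P : finPOrderType d) (s : rel P).
Implicit Types (D E F X Y : downset P) (x y z m a : P).

(** The colexicographic order of the downsets themselves, where [L_of] compares their antichains of
    maximal elements; [L_of_revlex] shows that the two agree. *)
Definition revlex : rel (downset P) := fun D E =>
  (D == E) || [exists m in E :\: D, [forall z in symdiff D E, s z m]].

Lemma in_symdiff (A B : {set P}) x : (x \in symdiff A B) = (x \in A) (+) (x \in B).
Proof. by rewrite !inE; do 2!case: (x \in _). Qed.

Lemma symdiffC (A B : {set P}) : symdiff A B = symdiff B A.
Proof. by rewrite /symdiff setUC. Qed.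

Lemma revlexP D E :
  reflect (D = E \/ exists m, [/\ m \in downset_set E, m \notin downset_set D
              & forall z, z \in symdiff D E -> s z m]) (revlex D E).
Proof.
apply: (iffP orP) => [[/eqP|]|[->|[m [Em Dm max_m]]]]; [by left | | by left | right].
  by case/exists_inP => m /setDP[Em Dm] /forall_inP max_m; right; exists m.
apply/exists_inP; exists m; first by rewrite inE Dm.
exact/forall_inP.
Qed.

Hypothesis ext_s : linear_extension s.
Let lin_s : linear_order s := proj1 ext_s.

Lemma max_symdiff D E : D != E ->
  exists2 m, m \in symdiff D E & forall z, z \in symdiff D E -> s z m.
Proof.
move=> neDE; have [Q0 | [x]] := set_0Vmem (symdiff D E); last exact: lin_max.
case/eqP: neDE; apply: downset_eqP => x.
by move/setP/(_ x): Q0; rewrite in_symdiff inE; do 2!case: (x \in _).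
Qed.

Lemma revlex_max D E m : m \in symdiff D E -> (forall z, z \in symdiff D E -> s z m) ->
  revlex D E = (m \in downset_set E).
Proof.
move=> Qm max_m; apply/revlexP/idP => [[eqDE|[m' [Em' Dm' max_m']]]|Em].
- by rewrite eqDE in_symdiff addbb in Qm.
- suff -> : m = m' by [].
  apply: (lin_anti lin_s); first exact: max_m'.
  by apply: max_m; rewrite in_symdiff Em' (negPf Dm').
by right; exists m; split=> //; move: Qm; rewrite in_symdiff Em; case: (m \in _).
Qed.

Lemma revlex_maxC D E m : m \in symdiff D E -> (forall z, z \in symdiff D E -> s z m) ->
  revlex E D = (m \in downset_set D).
Proof. by rewrite symdiffC; apply: revlex_max. Qed.

Lemma revlex_linear_extension : linear_extension revlex.
Proof.
split; last first.
  move=> D E subDE; have [-> | neDE] := eqVneq D E; first by apply/revlexP; left.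
  have [m Qm max_m] := max_symdiff neDE; rewrite (revlex_max Qm max_m).
  move: Qm; rewrite in_symdiff; case Dm: (m \in downset_set D) => //= _.
  exact: (subsetP subDE).
split.
- by move=> D; apply/revlexP; left.
- move=> D E /andP[DE ED]; apply/eqP; apply: contraLR DE => neDE.
  have [m Qm max_m] := max_symdiff neDE; rewrite (revlex_max Qm max_m).
  by move: ED (Qm); rewrite (revlex_maxC Qm max_m) in_symdiff => ->.
- move=> E D F /revlexP[-> //|[m [Em Dm max_m]]] /revlexP[<-|[m' [Fm' Em' max_m']]].
    by apply/revlexP; right; exists m.
  (* The larger of [m] and [m'] in [s] decides between [D] and [F], since a point where these differ
     is one where [D], [E] or [E], [F] differ. *)
  apply/revlexP; right.
  have sub z : z \in symdiff D F -> z \in symdiff D E \/ z \in symdiff E F.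
    by rewrite !in_symdiff; do 3!case: (z \in _); auto.
  have ne : m <> m' by move=> e; rewrite e (negPf Em') in Em.
  have [smm' | /(lin_notW lin_s) sm'm] := boolP (s m m').
    exists m'; split=> // [|z /sub[/max_m szm|]]; last exact: max_m'.
      apply/negP => Dm'; apply: ne; apply: (lin_anti lin_s) => //.
      by apply: max_m; rewrite in_symdiff Dm' (negPf Em').
    exact: (lin_trans lin_s szm).
  exists m; split=> // [|z /sub[|/max_m' szm]]; [|exact: max_m|].
    apply: contraT => Fm; case: ne; apply: (lin_anti lin_s) => //.
    by apply: max_m'; rewrite in_symdiff Em (negPf Fm).
  exact: (lin_trans lin_s szm).
move=> D E; have [-> | neDE] := eqVneq D E.
  by apply/orP; left; apply/revlexP; left.
have [m Qm max_m] := max_symdiff neDE.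
rewrite (revlex_max Qm max_m) (revlex_maxC Qm max_m).
by move: Qm; rewrite in_symdiff; do 2!case: (m \in _).
Qed.

Lemma exists_maximal D x : x \in downset_set D ->
  exists2 y, y \in maximal_elements D & x <= y.
Proof.
move=> Dx; have: x \in [set y in D | x <= y] by rewrite inE Dx /=.
case/(lin_max lin_s) => y; rewrite inE => /andP[Dy le_xy] max_y.
exists y => //; rewrite inE Dy; apply/forall_inP => z Dz; apply/implyP => le_yz.
apply/eqP/(lin_anti lin_s); last by apply: (proj2 ext_s).
by apply: max_y; rewrite inE Dz (le_trans le_xy).
Qed.

Lemma maximal_sub D x : x \in maximal_elements D -> x \in downset_set D.
Proof. by rewrite inE => /andP[]. Qed.

Lemma maximal_eq D x y : x \in maximal_elements D -> y \in downset_set D ->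
  x <= y -> y = x.
Proof. by rewrite inE => /andP[_ /forall_inP max_x] /max_x/implyP H /H/eqP. Qed.

(* The largest element of D △ E is a maximal element of the downset it belongs to,
   and every element of the symmetric difference of the two antichains lies below
   some element of D △ E. *)
Lemma L_of_revlex : L_of s =2 revlex.
Proof.
have half D E m : m \in downset_set E -> m \notin downset_set D ->
    (forall z, z \in symdiff D E -> s z m) ->
  [/\ m \in maximal_elements E, m \notin maximal_elements D &
     forall z, z \in symdiff (maximal_elements D) (maximal_elements E) -> s z m].
  move=> Em Dm max_m; have Mm : m \in maximal_elements E.
    rewrite inE Em; apply/forall_inP => z Ez; apply/implyP => le_mz.
    apply/eqP/(lin_anti lin_s); last exact: (proj2 ext_s).
    apply: max_m; rewrite in_symdiff Ez addbT; apply: contra Dm => Dz.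
    exact: downset_closed Dz.
  split=> // [|z]; first by apply: contra Dm => /maximal_sub.
  have below D1 E1 : symdiff D1 E1 = symdiff D E -> z \in maximal_elements D1 ->
      z \notin maximal_elements E1 -> s z m.
    move=> eqQ Mz nMz; have [Ez | nEz] := boolP (z \in downset_set E1); last first.
      by apply: max_m; rewrite -eqQ in_symdiff maximal_sub.
    have [y My le_zy] := exists_maximal Ez.
    apply: (lin_trans lin_s (proj2 ext_s _ _ le_zy)); apply: max_m.
    rewrite -eqQ in_symdiff (maximal_sub My) addbT; apply: contra nMz => Dy.
    by rewrite -(maximal_eq Mz Dy le_zy).
  rewrite in_symdiff; case MDz: (z \in maximal_elements D) => /=.
    by apply: below MDz.
  by move=> MEz; apply: (below E D) => //; rewrite 1?symdiffC ?MDz.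
move=> D E; rewrite /L_of; have [-> | neDE] := eqVneq D E.
  by symmetry; apply/revlexP; left.
have [m Qm max_m] := max_symdiff neDE; rewrite (revlex_max Qm max_m) /=.
rewrite /max_elt; set A := maximal_elements D; set B := maximal_elements E.
have [QAm max_A eqm] : [/\ m \in symdiff A B, forall z, z \in symdiff A B -> s z m
    & (m \in B) = (m \in downset_set E)].
  move: Qm; rewrite in_symdiff; case Em: (m \in downset_set E).
    rewrite addbT => Dm; have [MB MA maxz] := half D E m Em Dm max_m.
    by rewrite in_symdiff /A /B MB (negPf MA); split.
  rewrite addbF => Dm; have := half E D m Dm; rewrite Em symdiffC => /(_ isT max_m).
  case=> MA MB maxz; rewrite in_symdiff /A /B (negPf MB) MA; split=> //.
  by move=> z; rewrite symdiffC; apply: maxz.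
case: pickP => [m' /andP[Qm' /forall_inP max_m'] | /(_ m)/negP[]].
  suff -> : m' = m by [].
  by apply: (lin_anti lin_s); [apply: max_A | apply: max_m'].
by rewrite QAm; apply/forall_inP.
Qed.

End Revlex.

(** * The colexicographic orders of a realizer attain the bound *)

Section Realizer.
Variables (d : Order.disp_t) (P : finPOrderType d) (s1 s2 : rel P).
Hypotheses (ext1 : linear_extension s1) (ext2 : linear_extension s2).
Hypothesis realizer : forall x y : P, s1 x y -> s2 x y -> x <= y.
Implicit Types (D E X Y : downset P) (x y z m a : P).

Let lin1 : linear_order s1 := proj1 ext1.
Let lin2 : linear_order s2 := proj1 ext2.

Lemma incomparable_reversed x y : ~~ (x <= y) -> s1 x y -> s2 y x.
Proof.
by move=> nxy s1xy; apply: (lin_notW lin2); apply: contra nxy; apply: realizer.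
Qed.

Lemma setD_incomparable D E x y :
  x \in D :\: E -> y \in E :\: D -> ~~ (x <= y) /\ ~~ (y <= x).
Proof.
move=> /setDP[Dx Ex] /setDP[Ey Dy]; split.
  by apply: contra Ex => /downset_closed; apply.
by apply: contra Dy => /downset_closed; apply.
Qed.

(** The pair [(X, Y)] witnesses that the two maxima lie in different components of the symmetric
    difference. If they are on different sides, [(D, E)] itself or its swap does so; otherwise a
    point of the opposite side tells where to cut. *)
Lemma realizer_separates D E m1 m2 : ~~ (D <= E) -> ~~ (E <= D) ->
  m1 \in symdiff D E -> (forall z, z \in symdiff D E -> s1 z m1) ->
  m2 \in symdiff D E -> (forall z, z \in symdiff D E -> s2 z m2) ->
  exists X Y, [/\ (X, Y) \in block (D :&: E) (D :|: E),
     m1 \in X :\: Y & m2 \in Y :\: X].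
Proof.
move=> nDE nED; wlog Dm1 : D E nDE nED / m1 \in D :\: E.
  move=> wl Qm1; case/setUP: (Qm1) => [Dm1|Em1]; first by apply: wl.
  by rewrite symdiffC setIC setUC in Qm1 *; apply: wl.
move=> _ max1 Qm2 max2; case/setUP: (Qm2) => [Dm2|Em2]; last first.
  by exists D, E; rewrite block_self.
(* Both maxima are now in [D :\: E], all of whose elements are incomparable to [x]. In [s1], [m1] is
   above [x], while [m2], being above [x] in [s2], is below it; so cutting [D :\: E] at [x] along
   [s1] separates them. *)
have [x /setDP[Ex Dx]] : exists x, x \in E :\: D.
  by case/subsetPn: nED => x Ex Dx; exists x; rewrite inE Ex Dx.
have Qx : x \in symdiff D E by rewrite in_symdiff Ex (negPf Dx).
have EDx : x \in E :\: D by rewrite inE Ex Dx.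
have inc y : y \in D :\: E -> ~~ (x <= y) /\ ~~ (y <= x).
  by move=> Dy; have [] := setD_incomparable Dy EDx.
pose A1 := (D :&: E) :|: [set q in D :\: E | s1 x q].
pose A2 := E :|: [set q in D | s1 q x].
(* As s2 reverses the order of x and D \ E, no element of D \ E above x in s1 is
   comparable with one below it. *)
have dA1 : is_downset A1.
  apply/is_downsetP => u v le_vu; rewrite !inE.
  have [Ev | nEv] /= := boolP (v \in downset_set E).
    by case/orP => [/andP[Du _]|/andP[/andP[_ Du] _]];
      rewrite (downset_closed le_vu Du).
  case/orP=> [/andP[_ Eu]|/andP[/andP[nEu Du] s1xu]].
    by rewrite (downset_closed le_vu Eu) in nEv.
  have Dv := downset_closed le_vu Du; rewrite Dv /=.
  have [nxu nux] : ~~ (x <= u) /\ ~~ (u <= x) by apply: inc; rewrite inE nEu.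
  have [nxv nvx] : ~~ (x <= v) /\ ~~ (v <= x) by apply: inc; rewrite inE nEv.
  apply: contraT => /(lin_notW lin1)/(incomparable_reversed nvx) s2xv.
  have s2ux := incomparable_reversed nxu s1xu.
  have s2vu := proj2 ext2 _ _ le_vu.
  have e : x = u.
    by apply: (lin_anti lin2) => //; apply: (lin_trans lin2 s2xv).
  by rewrite e lexx in nxu.
have dA2 : is_downset A2.
  apply/is_downsetP => u v le_vu; rewrite !inE.
  case/orP=> [/(downset_closed le_vu)-> //|/andP[Du s1ux]].
  rewrite (downset_closed le_vu Du) (lin_trans lin1 _ s1ux) ?orbT //.
  exact: (proj2 ext1).
have [X memX] := exists_downset dA1; have [Y memY] := exists_downset dA2.
have s2m1x : s2 m1 x.
  by apply: (incomparable_reversed (proj1 (inc _ Dm1))); apply: max1.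
have s1m2x : s1 m2 x.
  apply: (lin_notW lin1).
  apply/negP => /(incomparable_reversed (proj1 (inc _ Dm2))) s2m2x.
  have e : x = m2 by apply: (lin_anti lin2) => //; apply: max2.
  by rewrite -e inE Ex in Dm2.
have noteq q : q \in downset_set D -> (s1 x q && s1 q x) = false.
  move=> Dq; apply/negP => /andP[sxq sqx]; have e := lin_anti lin1 sxq sqx.
  by rewrite e Dq in Dx.
have tot q := lin_total lin1 x q.
exists X, Y; split.
- apply/blockP => q; rewrite memX memY !inE /=.
  case Dq: (q \in downset_set D); last by rewrite /=; case: (q \in _).
  move: (noteq q Dq) (tot q).
  by case: (q \in _); case: (s1 x q); case: (s1 q x).
- move: Dm1 (noteq m1); rewrite !(inE, memX, memY) => /andP[/negPf-> Dm1].
  by rewrite Dm1 max1 //= => /(_ isT) ->.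
move: Dm2 (noteq m2); rewrite !(inE, memX, memY) => /andP[/negPf-> Dm2].
by rewrite Dm2 s1m2x /= !andbT => /(_ isT) ->.
Qed.

(** Every pair with [m2] in its first and [m1] in its second entry is reversed, and these pairs form
    a quarter of the block. *)
Lemma revlex_reversals D E : ~~ (D <= E) -> ~~ (E <= D) ->
  (#|block (D :&: E) (D :|: E)|
   <= #|reversals (revlex s1) (revlex s2) (D :&: E) (D :|: E)| * 4)%N.
Proof.
move=> nDE nED; have neDE : D != E by apply: contra nDE => /eqP->.
have [m1 Qm1 max1] := max_symdiff ext1 neDE.
have [m2 Qm2 max2] := max_symdiff ext2 neDE.
have [X [Y [bXY m1XY m2XY]]] := realizer_separates nDE nED Qm1 max1 Qm2 max2.
have eqI : D :&: E = X :&: Y by move: bXY; rewrite inE => /andP[/eqP->].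
have eqU : D :|: E = X :|: Y by move: bXY; rewrite inE => /andP[_ /eqP->].
rewrite eqI eqU in bXY *; have [_ <-] := block_quarters m1XY m2XY.
rewrite leq_mul2r /= -(card_block_swap _ _ (fun p => (m1 \in _) && _)).
apply/subset_leq_card/subsetP => p; rewrite inE => /and3P[bp p2m1 p1m2].
have eqQ : symdiff p.1 p.2 = symdiff D E.
  apply/setP => z; rewrite !in_symdiff; move/blockP: bp => /(_ z)[].
  move/setP/(_ z): eqI; move/setP/(_ z): eqU; rewrite !inE => <- <-.
  by do 4!case: (z \in _).
rewrite /reversals inE bp /=.
have -> : revlex s1 p.1 p.2 by rewrite (revlex_max ext1 (m := m1)) ?eqQ.
have -> : revlex s2 p.2 p.1 by rewrite (revlex_maxC ext2 (m := m2)) ?eqQ.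
rewrite !andbT; apply: contraL Qm1 => /eqP e.
by rewrite -eqQ e in_symdiff addbb.
Qed.

End Realizer.

(** * Tight pairs of linear extensions *)

(** Equality in [reversals_bound] on every block that contains an incomparable pair. *)
Definition tight (d : Order.disp_t) (P : finPOrderType d)
    (L1 L2 : rel (downset P)) : Prop :=
  forall D E : downset P, ~~ (D <= E) -> ~~ (E <= D) ->
  (#|block (D :&: E) (D :|: E)| <= #|reversals L1 L2 (D :&: E) (D :|: E)| * 4)%N.

Lemma tightC (d : Order.disp_t) (P : finPOrderType d) (L1 L2 : rel (downset P)) :
  tight L1 L2 -> tight L2 L1.
Proof.
move=> tightL D E nDE nED; apply: leq_trans (tightL D E nDE nED) _.
rewrite leq_mul2r /= /reversals -(card_block_swap _ _ (fun p => [&& _, L1 _ _ & _])).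
apply/subset_leq_card/subsetP => p; rewrite inE => /and4P[bp ne L21 L12].
by rewrite inE bp eq_sym ne L12.
Qed.

Lemma diametral_tight (d : Order.disp_t) (P : finPOrderType d)
    (L1 L2 : rel (downset P)) :
  two_dimensional P -> diametral_pair L1 L2 -> tight L1 L2.
Proof.
case=> s1 [s2 [ext_s1 ext_s2 realizer]] [ext1 ext2 diam] D E nDE nED.
have rlz (x y : P) : s1 x y -> s2 x y -> x <= y by move=> s1xy s2xy; apply/realizer.
(* A reversed pair is incomparable, so wherever [L1], [L2] have reversals the realizer attains the
   maximum. *)
have le_rev (k : {set P} * {set P}) : (#|reversals L1 L2 k.1 k.2|
    <= #|reversals (revlex s1) (revlex s2) k.1 k.2|)%N.
  have [-> | [p]] := set_0Vmem (reversals L1 L2 k.1 k.2); first by rewrite cards0.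
  rewrite inE => /and4P[bp ne L12 L21].
  have n12 : ~~ (p.1 <= p.2).
    apply/negP => /(proj2 ext2) L12'; case/eqP: ne.
    exact: (lin_anti (proj1 ext2) L12' L21).
  have n21 : ~~ (p.2 <= p.1).
    apply/negP => /(proj2 ext1) L21'; case/eqP: ne.
    exact: (lin_anti (proj1 ext1) L12 L21').
  have := revlex_reversals ext_s1 ext_s2 rlz n12 n21.
  move: bp; rewrite inE => /andP[/eqP-> /eqP->] le_b.
  have := leq_trans (reversals_bound k.1 k.2 ext1 ext2) le_b.
  by rewrite leq_mul2r.
have le_dist := diam _ _ (revlex_linear_extension ext_s1)
  (revlex_linear_extension ext_s2).
have eq_rev : #|reversals L1 L2 (D :&: E) (D :|: E)|
    = #|reversals (revlex s1) (revlex s2) (D :&: E) (D :|: E)|.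
  (* The distances are sums over blocks, compared term by term; the larger sum does not exceed the
     smaller one by maximality, so all terms are equal. *)
  have /leqif_sum [le_sum eq_sum] : forall k : {set P} * {set P}, true ->
      (#|reversals L1 L2 k.1 k.2| <= #|reversals (revlex s1) (revlex s2) k.1 k.2|
       ?= iff (#|reversals L1 L2 k.1 k.2|
               == #|reversals (revlex s1) (revlex s2) k.1 k.2|))%N.
    by move=> k _; apply/leqif_eq/le_rev.
  have lin1 := proj1 ext1; have lin_s1 := proj1 (revlex_linear_extension ext_s1).
  move: le_dist; rewrite !distance_reversals //.
  rewrite leqNgt ltn_neqAle le_sum andbT negbK eq_sum.
  by move/forallP/(_ (D :&: E, D :|: E))/eqP.
by rewrite eq_rev; apply: revlex_reversals.
Qed.

Lemma principal_linear_extension (d : Order.disp_t) (P : finPOrderType d)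
    (L : rel (downset P)) : linear_extension L -> linear_extension (principal_order L).
Proof.
case=> linL extL; split; last first.
  by move=> x y le_xy; apply: extL; apply: principal_sub; rewrite inE.
split.
- by move=> x; exact: (lin_refl linL).
- move=> x y /andP[Lxy Lyx]; have e := lin_anti linL Lxy Lyx.
  have : x \in downset_set (principal x) by rewrite inE.
  have : y \in downset_set (principal y) by rewrite inE.
  by rewrite {1}e -{1}e !inE => le1 le2; apply: le_anti; rewrite le1 le2.
- by move=> y x z; apply: (lin_trans linL).
by move=> x y; exact: (lin_total linL).
Qed.

Section Tight.
Variables (d : Order.disp_t) (P : finPOrderType d) (L1 L2 : rel (downset P)).
Hypotheses (ext1 : linear_extension L1) (ext2 : linear_extension L2).
Hypothesis tightL : tight L1 L2.
Implicit Types (D E X Y : downset P) (x y z m a : P) (I U : {set P}).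

Let lin1 : linear_order L1 := proj1 ext1.
Let lin2 : linear_order L2 := proj1 ext2.
Let s1 := principal_order L1.
Let s2 := principal_order L2.

(** Tightness leaves room for at most $1/2-1/4$ of the block as agreements. The pairs with [r] and
    [r'] in the first entry are already a quarter, so they are all of them. *)
Lemma tight_agreements I U X0 Y0 r r' : (X0, Y0) \in block I U ->
  r \in X0 :\: Y0 -> r' \in Y0 :\: X0 ->
  (forall X Y, (X, Y) \in block I U -> r \in downset_set X -> r' \in downset_set X ->
     L1 Y X /\ L2 Y X) ->
  forall X Y, (X, Y) \in block I U -> L1 Y X -> L2 Y X ->
  r \in downset_set X /\ r' \in downset_set X.
Proof.
rewrite inE => /andP[/eqP <- /eqP <-] /= rXY rYX agree X Y bXY L1YX L2YX.
have [quarter _] := block_quarters rXY rYX.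
set B := block _ _ in agree bXY quarter; set C := [set p in B | _] in quarter.
have neIU : X0 :&: Y0 != X0 :|: Y0.
  by apply/eqP => /setP/(_ r); move/setDP: rXY; rewrite !inE => -[-> /negPf->].
have [n12 n21] : ~~ (X0 <= Y0) /\ ~~ (Y0 <= X0).
  case/setDP: rXY => Xr Yr; case/setDP: rYX => Yr' Xr'.
  by split; apply/subsetPn; [exists r | exists r'].
have le_b := tightL n12 n21.
have half := block_half lin2 neIU.
have le_a := reversals_agreements L2 (X0 :&: Y0) (X0 :|: Y0) lin1.
have sCA : C \subset agreements L1 L2 (X0 :&: Y0) (X0 :|: Y0).
  apply/subsetP => -[X' Y']; rewrite inE => /and3P[bp Xr Xr'].
  by rewrite /agreements inE bp /=; apply/andP/agree.
have /eqP eqCA : C == agreements L1 L2 (X0 :&: Y0) (X0 :|: Y0).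
  rewrite eqEcard sCA /=; move: half le_b le_a quarter; rewrite -/B.
  move: #|C| #|B| #|agreements _ _ _ _| #|reversals _ _ _ _| #|_| => c b a t f; lia.
have : (X, Y) \in C by rewrite eqCA /agreements inE bXY /= L1YX.
by rewrite inE => /and3P[].
Qed.

(** In the block of [principal x] and [principal y], a first entry containing [x] and [y] is
    everything, so [tight_agreements] applies and the two principal downsets are not themselves an
    agreement. *)
Lemma principal_realizer x y : s1 x y -> s2 x y -> x <= y.
Proof.
move=> s1xy s2xy; apply: contraT => nxy; have [le_yx | nyx] := boolP (y <= x).
  have s1yx := proj2 (principal_linear_extension ext1) _ _ le_yx.
  have e := lin_anti (proj1 (principal_linear_extension ext1)) s1xy s1yx.
  by rewrite e lexx in nxy.
have bxy := block_self (principal x) (principal y).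
have xxy : x \in principal x :\: principal y by rewrite !inE lexx nxy.
have yyx : y \in principal y :\: principal x by rewrite !inE lexx nyx.
have agree X Y :
    (X, Y) \in block (principal x :&: principal y) (principal x :|: principal y) ->
    x \in downset_set X -> y \in downset_set X -> L1 Y X /\ L2 Y X.
  move=> /blockP bXY Xx Xy.
  suff le_YX : Y <= X by split; [apply: (proj2 ext1) | apply: (proj2 ext2)].
  apply/subsetP => z Yz; case: (bXY z); rewrite Yz orbT !inE => _ /esym/orP[] le_z.
    exact: downset_closed le_z Xx.
  exact: downset_closed le_z Xy.
have [] := tight_agreements bxy xxy yyx agree (swap_block bxy) s1xy s2xy.
by rewrite inE (negPf nxy).
Qed.

(** * Induction step: comparing two downsets by the maximum of their difference *)

Section Step.
Variables D E : downset P.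
Hypothesis IH1 : forall D' E', (#|D' :|: E'| < #|D :|: E|)%N ->
  revlex s1 D' E' -> L1 D' E'.
Hypothesis IH2 : forall D' E', (#|D' :|: E'| < #|D :|: E|)%N ->
  revlex s2 D' E' -> L2 D' E'.

(** Suppose [L1 D E] although the [s1]-maximum [m] of the difference is in [D]. Then the
    [s2]-maximum [m'] is in [E], and [m], [m'] are the greatest elements of [D :\: E] and [E :\: D].
    A maximal element of the union lying in the intersection, or else the absence of one, gives the
    contradiction. *)
Lemma revlex_step : revlex s1 E D -> L1 E D.
Proof.
case/revlexP => [-> | [m [Dm Em max1]]]; first exact: (lin_refl lin1).
rewrite symdiffC in max1; apply: contraT => nLED; have LDE := lin_notW lin1 nLED.
have small X Y w : {subset X :|: Y <= D :|: E} -> w \in D :|: E ->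
    w \notin downset_set X -> w \notin downset_set Y -> (#|X :|: Y| < #|D :|: E|)%N.
  move=> sub Uw Xw Yw; apply: proper_card; apply/properP; split; first exact/subsetP.
  by exists w; rewrite // inE negb_or Xw.
(* The induction hypothesis is used through a point [w] of the union that both new downsets miss. *)
have IH1' X Y z w : {subset X :|: Y <= D :|: E} -> w \in D :|: E ->
    w \notin downset_set X -> w \notin downset_set Y ->
    z \in downset_set Y -> z \notin downset_set X ->
    (forall v, v \in symdiff X Y -> s1 v z) -> L1 X Y.
  move=> sub Uw Xw Yw Yz Xz max_z; apply: IH1; first exact: small sub Uw Xw Yw.
  by apply/revlexP; right; exists z.
have IH2' X Y z w : {subset X :|: Y <= D :|: E} -> w \in D :|: E ->
    w \notin downset_set X -> w \notin downset_set Y ->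
    z \in downset_set Y -> z \notin downset_set X ->
    (forall v, v \in symdiff X Y -> s2 v z) -> L2 X Y.
  move=> sub Uw Xw Yw Yz Xz max_z; apply: IH2; first exact: small sub Uw Xw Yw.
  by apply/revlexP; right; exists z.
have nDE : ~~ (D <= E) by apply/subsetPn; exists m.
have nED : ~~ (E <= D) by apply: contra nLED; apply: (proj2 ext1).
have neDE : D != E by apply: contra nDE => /eqP->.
have ext_s1 := principal_linear_extension ext1.
have ext_s2 := principal_linear_extension ext2.
have Qm : m \in symdiff D E by rewrite in_symdiff Dm (negPf Em).
have [m' Qm' max2] := max_symdiff ext_s2 neDE.
have Um : m \in D :|: E by rewrite inE Dm.
have Um' : m' \in D :|: E by move: Qm'; rewrite !inE; do 2!case: (m' \in _).
have [X0 [Y0 [bXY0 mXY0 m'XY0]]] :=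
  realizer_separates ext_s1 ext_s2 principal_realizer nDE nED Qm max1 Qm' max2.
have [X0m Y0m] := setDP mXY0; have [Y0m' X0m'] := setDP m'XY0.
have blockQ X Y v : (X, Y) \in block (D :&: E) (D :|: E) ->
    v \in symdiff D E -> v \in downset_set X -> v \notin downset_set Y.
  move/blockP => /(_ v)[]; rewrite in_symdiff !inE /=.
  by do 4!case: (v \in _).
(* Cutting [X] down to [meetd X X0] drops [m'] and keeps [m], so the induction hypothesis for [L1]
   places [Y] below it; [Y0] does the same for [L2] with the roles of [m] and [m'] exchanged. *)
have agree X Y : (X, Y) \in block (D :&: E) (D :|: E) ->
    m \in downset_set X -> m' \in downset_set X -> L1 Y X /\ L2 Y X.
  move=> bXY Xm Xm'; have Ym := blockQ _ _ _ bXY Qm Xm.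
  have Ym' := blockQ _ _ _ bXY Qm' Xm'.
  have symsub Z v : (v \in downset_set Z -> v \in D :|: E) ->
      (v \in D :&: E -> v \in downset_set Z) ->
      v \in symdiff Y (meetd X Z) -> v \in symdiff D E.
    move/blockP: bXY => /(_ v)[]; rewrite !in_symdiff in_meetd !inE /=.
    by do 5!case: (v \in _) => //=; move=> _ _ H1 H2;
      try (by have := H1 isT); have := H2 isT.
  have subU Z : {subset Y :|: meetd X Z <= D :|: E}.
    move=> v; move/blockP: bXY => /(_ v)[]; rewrite !inE /=.
    by do 5!case: (v \in _).
  have inX0 v := (blockP _ _ _ bXY0 v); split.
    apply: (lin_trans lin1 (y := meetd X X0)); last exact/(proj2 ext1)/meetd_sub.
    apply: (IH1' _ _ m m'); rewrite ?in_meetd ?Xm ?X0m ?Xm' //.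
    move=> v Qv; apply: max1; apply: symsub Qv; case: (inX0 v) => /=;
      by do 4?case: (v \in _).
  apply: (lin_trans lin2 (y := meetd X Y0)); last exact/(proj2 ext2)/meetd_sub.
  apply: (IH2' _ _ m' m); rewrite ?in_meetd ?Xm ?Y0m' ?Xm' //.
  move=> v Qv; apply: max2; apply: symsub Qv; case: (inX0 v) => /=;
    by do 4?case: (v \in _).
have bDE := block_self D E.
have L2ED : L2 E D.
  apply: (lin_notW lin2); apply/negP => L2DE.
  have [] := tight_agreements bXY0 mXY0 m'XY0 agree (swap_block bDE) LDE L2DE.
  by rewrite (negPf Em).
have Dm' : m' \notin downset_set D.
  by apply: contra nLED => Dm'; have [] := agree D E bDE Dm Dm'.
have Em' : m' \in downset_set E by move: Qm'; rewrite in_symdiff (negPf Dm').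
(* Otherwise [D1] misses [x], and the induction hypothesis gives [L1 E D1], hence [L1 E D]. *)
have subm x : x \in downset_set D -> x \notin downset_set E -> x <= m.
  move=> Dx Ex; apply: contraT => nxm; case/negP: nLED.
  pose D1 := joind (meetd D E) (principal m).
  have le_D1 : D1 <= D.
    apply/subsetP => z; rewrite in_joind in_meetd => /orP[/andP[]//|].
    by rewrite inE => /downset_closed; apply.
  apply: (lin_trans lin1 (y := D1)); last exact: (proj2 ext1).
  apply: (IH1' _ _ m x) => //.
  - by move=> z /setUP[Ez|/(subsetP le_D1) Dz]; rewrite inE ?Ez ?Dz ?orbT.
  - by rewrite inE Dx.
  - by rewrite in_joind in_meetd (negPf Ex) andbF inE.
  - by rewrite in_joind orbC inE lexx.
  move=> z Qz; apply: max1; move: Qz; rewrite !in_symdiff in_joind in_meetd.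
  have := subsetP le_D1 z; rewrite in_joind in_meetd.
  by do 3!case: (z \in _) => //=; move=> H; have := H isT.
have subm' x : x \in downset_set E -> x \notin downset_set D -> x <= m'.
  move=> Ex Dx; apply: contraT => nxm; case/eqP: neDE; apply: (lin_anti lin2) => //.
  pose E1 := joind (meetd D E) (principal m').
  have le_E1 : E1 <= E.
    apply/subsetP => z; rewrite in_joind in_meetd => /orP[/andP[]//|].
    by rewrite inE => /downset_closed; apply.
  apply: (lin_trans lin2 (y := E1)); last exact: (proj2 ext2).
  apply: (IH2' _ _ m' x) => //.
  - by move=> z /setUP[Ez|/(subsetP le_E1) Dz]; rewrite inE ?Ez ?Dz ?orbT.
  - by rewrite inE Ex orbT.
  - by rewrite in_joind in_meetd (negPf Dx) inE.
  - by rewrite in_joind orbC inE lexx.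
  move=> z Qz; apply: max2; move: Qz; rewrite !in_symdiff in_joind in_meetd.
  have := subsetP le_E1 z; rewrite in_joind in_meetd.
  by do 3!case: (z \in _) => //=; move=> H; have := H isT.
(* If some a in I is maximal in U, the block over I \ a has {a} as an extra component,
   and E vs D \ a is an agreement there. *)
have [/exists_inP[a /setIP[Da Ea] /forall_inP max_a] | noa] :=
    boolP [exists a in D :&: E, [forall u in D :|: E, (a <= u) ==> (u == a)]].
  have minus_a X : {subset downset_set X <= D :|: E} ->
      exists Xa : downset P, forall x,
        (x \in downset_set Xa) = (x != a) && (x \in downset_set X).
    move=> subX; have: is_downset (X :\ a).
      apply/is_downsetP => x y le_yx; rewrite !inE => /andP[nxa Xx].
      rewrite (downset_closed le_yx Xx) andbT; apply: contra nxa => /eqP eya.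
      by rewrite eya in le_yx; have /implyP/(_ le_yx) := max_a x (subX x Xx).
    by case/exists_downset => Xa memXa; exists Xa => x; rewrite memXa !inE.
  have [Da' memDa] : exists Xa : downset P, forall x,
      (x \in downset_set Xa) = (x != a) && (x \in downset_set D).
    by apply: minus_a => x; rewrite inE => ->.
  have [Ea' memEa] : exists Xa : downset P, forall x,
      (x \in downset_set Xa) = (x != a) && (x \in downset_set E).
    by apply: minus_a => x; rewrite inE orbC => ->.
  have Ua : a \in D :|: E by rewrite inE Da.
  have nma : m != a by apply: contraNneq Em => ->.
  have nm'a : m' != a by apply: contraNneq Dm' => ->.
  pose I := (D :&: E) :\ a.
  have b0 : (meetd D E, joind Da' Ea') \in block I (D :|: E).
    apply/blockP => x; rewrite in_meetd in_joind memDa memEa !inE.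
    by have [->|_] := eqVneq x a; rewrite ?Da ?Ea //=; do 2!case: (x \in _).
  have aXY : a \in meetd D E :\: joind Da' Ea'.
    by rewrite in_setD in_joind memDa memEa eqxx in_meetd Da Ea.
  have mXY : m \in joind Da' Ea' :\: meetd D E.
    by rewrite in_setD in_joind memDa memEa nma in_meetd Dm (negPf Em).
  have agree_a X Y : (X, Y) \in block I (D :|: E) -> a \in downset_set X ->
      m \in downset_set X -> L1 Y X /\ L2 Y X.
    move=> /blockP bXY Xa Xm.
    have bI x : (x \in downset_set X) && (x \in downset_set Y) =
        [&& x != a, x \in downset_set D & x \in downset_set E].
      by case: (bXY x) => /= -> _; rewrite !inE.
    have bU x : (x \in downset_set X) || (x \in downset_set Y) =
        (x \in downset_set D) || (x \in downset_set E).
      by case: (bXY x) => /= _ ->; rewrite !inE.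
    have subX : {subset downset_set X <= D :|: E}.
      by move=> x Xx; rewrite inE -bU Xx.
    have [Xa' memXa] := minus_a X subX.
    have Ya : a \notin downset_set Y by have := bI a; rewrite Xa eqxx /= => ->.
    have Ym : m \notin downset_set Y.
      by have := bI m; rewrite Xm (negPf Em) !andbF /= => ->.
    split.
      apply: (lin_trans lin1 (y := Xa')); last first.
        by apply: (proj2 ext1); apply/subsetP => x; rewrite memXa => /andP[].
      apply: (IH1' _ _ m a) => //.
      - by move=> x; rewrite !inE memXa -bU => /orP[->|/andP[_ ->]]; rewrite ?orbT.
      - by rewrite memXa eqxx.
      - by rewrite memXa nma.
      move=> x Qx; apply: max1; move: Qx (bI x) (bU x); rewrite !in_symdiff memXa.
      have [->|_] := eqVneq x a; first by rewrite (negPf Ya).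
      by rewrite /=; do 4!case: (x \in _).
    (* For [L2] the chain is [Y <= E], then [L2 E D], then [D <= X]. A point of [Y] outside [E]
       would be below [m], hence in [X], hence in [I], which is contained in [E]. *)
    have le_YE : Y <= E.
      apply/subsetP => z Yz; apply: contraT => Ez.
      have Dz : z \in downset_set D by have := bU z; rewrite Yz orbT (negPf Ez) orbF.
      have Xz := downset_closed (subm z Dz Ez) Xm.
      by have := bI z; rewrite Xz Yz (negPf Ez) !andbF.
    have le_DX : D <= X.
      apply/subsetP => z Dz; apply: contraT => Xz.
      have Yz : z \in downset_set Y by have := bU z; rewrite Dz (negPf Xz).
      have Ez := subsetP le_YE z Yz.
      have := bI z; rewrite (negPf Xz) Dz Ez /= andbT => /esym/negbFE/eqP eza.
      by rewrite eza Xa in Xz.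
    apply: (lin_trans lin2 (proj2 ext2 _ _ le_YE)).
    by apply: (lin_trans lin2 L2ED); apply: (proj2 ext2).
  have bEDa : (E, Da') \in block I (D :|: E).
    apply/blockP => x; rewrite /= memDa !inE.
    by have [->|_] := eqVneq x a; rewrite ?Da ?Ea //=; do 2!case: (x \in _).
  have L1DaE : L1 Da' E.
    apply: (lin_trans lin1 _ LDE); apply: (proj2 ext1); apply/subsetP => x.
    by rewrite memDa => /andP[].
  have L2DaE : L2 Da' E.
    apply: (lin_trans lin2 (y := Ea')); last first.
      by apply: (proj2 ext2); apply/subsetP => x; rewrite memEa => /andP[].
    apply: (IH2' _ _ m' a) => //.
    - by move=> x; rewrite !inE memDa memEa => /orP[] /andP[_ ->]; rewrite ?orbT.
    - by rewrite memDa eqxx.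
    - by rewrite memEa eqxx.
    - by rewrite memEa nm'a.
    - by rewrite memDa (negPf Dm') andbF.
    move=> x Qx; apply: max2; move: Qx; rewrite !in_symdiff memDa memEa.
    by case: (x != a).
  have [_ mE] := tight_agreements b0 aXY mXY agree_a bEDa L1DaE L2DaE.
  by rewrite mE in Em.
(* Otherwise U is generated by m and m', and E can be compared with the downset of m. *)
have coverU z : z \in D :|: E -> z <= m \/ z <= m'.
  move=> Uz; have [y] := @exists_maximal _ _ _ ext_s1 (joind D E) z Uz.
  rewrite inE => /andP[Uy max_y] le_zy.
  have ny : y \notin D :&: E.
    by apply: contra noa => Iy; apply/exists_inP; exists y.
  move: Uy ny; rewrite !inE.
  case Dy: (y \in downset_set D); case Ey: (y \in downset_set E) => //= _ _.
    by left; apply: le_trans le_zy (subm _ _ _); rewrite ?Dy ?Ey.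
  by right; apply: le_trans le_zy (subm' _ _ _); rewrite ?Dy ?Ey.
have bpE := block_self (principal m) E.
have le_pD : principal m <= D by apply: principal_sub.
have mp : m \in principal m :\: E by rewrite !inE Em lexx.
have m'p : m' \in E :\: principal m.
  by rewrite inE Em' andbT; apply: contra Dm'; apply: (subsetP le_pD).
have L1pE : L1 (principal m) E.
  by apply: (lin_trans lin1 _ LDE); apply: (proj2 ext1).
have agree_p X Y : (X, Y) \in block (principal m :&: E) (principal m :|: E) ->
    m \in downset_set X -> m' \in downset_set X -> L1 Y X /\ L2 Y X.
  move=> /blockP bXY Xm Xm'.
  suff le_YX : Y <= X by split; [apply: (proj2 ext1) | apply: (proj2 ext2)].
  apply/subsetP => z Yz; have: z \in D :|: E.
    case: (bXY z) => _; rewrite Yz orbT => /esym/setUP[/(subsetP le_pD) Dz|Ez];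
    by rewrite inE ?Dz ?Ez ?orbT.
  by case/coverU => /downset_closed; apply.
have L2Ep : L2 E (principal m).
  apply: (lin_notW lin2); apply/negP => L2pE.
  have [mE _] := tight_agreements bpE mp m'p agree_p (swap_block bpE) L1pE L2pE.
  by rewrite mE in Em.
(* The principal downset of [m'] is contained in [E], which [L2] puts below that of [m]; this
   contradicts the choice of [m'] as [s2]-maximum. *)
have s2m'm : s2 m' m.
  by apply: (lin_trans lin2 _ L2Ep); apply: (proj2 ext2); apply: principal_sub.
have e : m = m' by apply: (lin_anti (proj1 ext_s2)) => //; apply: max2.
by rewrite -e Dm in Dm'.
Qed.

End Step.
End Tight.

(** * Tight pairs are colexicographic; conclusion *)

Section TightRevlex.
Variables (d : Order.disp_t) (P : finPOrderType d) (L1 L2 : rel (downset P)).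
Hypotheses (ext1 : linear_extension L1) (ext2 : linear_extension L2).
Hypothesis tightL : tight L1 L2.

(** Both orders are treated in one induction, because the step for either of them uses the
    hypothesis for both. *)
Lemma tight_sub_revlex (D E : downset P) :
  (revlex (principal_order L1) D E -> L1 D E) /\
  (revlex (principal_order L2) D E -> L2 D E).
Proof.
have [n] := ubnP #|D :|: E|; elim: n D E => // n IHn D E; rewrite ltnS => leUn.
have IH (D' E' : downset P) : (#|D' :|: E'| < #|E :|: D|)%N ->
    (revlex (principal_order L1) D' E' -> L1 D' E') /\
    (revlex (principal_order L2) D' E' -> L2 D' E').
  by rewrite [E :|: D]setUC => lt; apply: IHn; apply: leq_trans lt leUn.
split; [apply: (revlex_step ext1 ext2 tightL)
       | apply: (revlex_step ext2 ext1 (tightC tightL))];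
  by move=> D' E' /IH[].
Qed.

(** A linear order contained in another one is equal to it. *)
Lemma tight_revlex : L1 =2 revlex (principal_order L1).
Proof.
have ext_s := principal_linear_extension ext1.
move=> D E; apply/idP/idP => [LDE|]; last by case: (tight_sub_revlex D E).
have lin_r := proj1 (revlex_linear_extension ext_s).
have /orP[// | rED] := lin_total lin_r D E.
have [/(_ rED) LED _] := tight_sub_revlex E D.
by rewrite (lin_anti (proj1 ext1) LDE LED) (lin_refl lin_r).
Qed.

End TightRevlex.

(** Two linear extensions can reverse only incomparable pairs, and a realizer reverses all of
    these. *)
Lemma realizer_diametral (d : Order.disp_t) (P : finPOrderType d) (s1 s2 : rel P) :
  linear_extension s1 -> linear_extension s2 ->
  (forall x y, s1 x y -> s2 x y -> x <= y) -> diametral_pair s1 s2.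
Proof.
move=> ext1 ext2 rlz; split=> // M1 M2 extM1 extM2.
apply/subset_leq_card/subsetP => e; rewrite !inE.
case/existsP => x /existsP[y /and4P[/eqP-> neq M1xy M2yx]].
have nxy : ~~ (x <= y).
  by apply: contra neq => /(proj2 extM2) M2xy; apply/eqP/(lin_anti (proj1 extM2)).
have nyx : ~~ (y <= x).
  by apply: contra neq => /(proj2 extM1) M1yx; apply/eqP/(lin_anti (proj1 extM1)).
have [s1xy | /(lin_notW (proj1 ext1)) s1yx] := boolP (s1 x y); apply/existsP.
  exists x; apply/existsP; exists y; rewrite eqxx neq s1xy /=.
  exact: incomparable_reversed ext2 rlz _ _ nxy s1xy.
exists y; apply/existsP; exists x; rewrite setUC eqxx eq_sym neq s1yx /=.
exact: incomparable_reversed ext2 rlz _ _ nyx s1yx.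
Qed.

Theorem theorem5 (d : Order.disp_t) (P : finPOrderType d)
    (L Lbar : rel (downset P)) :
  two_dimensional P ->
  diametral_pair L Lbar ->
  let sigma := principal_order L in
  exists sigmabar : rel P,
    [/\ diametral_pair sigma sigmabar,
        L =2 L_of sigma
      & Lbar =2 L_of sigmabar].
Proof.
move=> dimP diam sigma; have tightL := diametral_tight dimP diam.
case: diam => ext1 ext2 _; exists (principal_order Lbar).
have ext_s1 := principal_linear_extension ext1.
have ext_s2 := principal_linear_extension ext2.
split; first by apply: realizer_diametral => //; apply: principal_realizer.
  by move=> D E; rewrite L_of_revlex // -(tight_revlex ext1 ext2).
by move=> D E; rewrite L_of_revlex // -(tight_revlex ext2 ext1) //; apply: tightC.
Qed.
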